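(* Let $\Sigma$ be a linear control system on a connected Lie group $G$ satisfying the rank-condition, let $(\varphi_t)_{t\in\mathbb{R}}$ be the flow of its drift, let $\mathcal{A}$ be its reachable set from the identity, and let $\mathcal{S}_\Sigma=\bigcap_{t\in\mathbb{R}}\varphi_t(\mathcal{A})$. Then: (1) $\mathcal{S}_\Sigma$ is the greatest $\varphi$-invariant subset of $\mathcal{A}$, i.e. it is a $\varphi$-invariant subset of $\mathcal{A}$ and contains every $\varphi$-invariant subset of $\mathcal{A}$; (2) for any $\tau_0\ge 0$, $\mathcal{S}_\Sigma=\bigcap_{t\ge\tau_0}\varphi_t(\mathcal{A})$; (3) $x\in\mathcal{S}_\Sigma$ if and only if $\varphi_t(x)\in\mathcal{A}$ for all $t\le 0$; (4) $\mathcal{S}_\Sigma$ is a semigroup, i.e. $xy\in\mathcal{S}_\Sigma$ for all $x,y\in\mathcal{S}_\Sigma$.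
   Context: Let $G$ be a connected Lie group with identity $e$ and Lie algebra $\mathfrak{g}$, identified with the set of right-invariant vector fields. A vector field $\mathcal{X}$ on $G$ is linear if its flow $(\varphi_t)_{t\in\mathbb{R}}$ is a one-parameter subgroup of $\mathrm{Aut}(G)$. The derivation $\mathcal{D}$ of $\mathfrak{g}$ determined by $\mathcal{X}$ satisfies $(d\varphi_t)_e=e^{t\mathcal{D}}$ for all $t\in\mathbb{R}$. A linear control system $\Sigma$ on $G$ is the family of differential equations $\dot g(t)=\mathcal{X}(g(t))+\sum_{j=1}^m u_j(t)X^j(g(t))$, where the drift $\mathcal{X}$ is a linear vector field, $X^1,\dots,X^m$ are right-invariant vector fields, and $u=(u_1,\dots,u_m)\in\mathcal{U}$, with $\mathcal{U}=L^\infty(\mathbb{R},\Omega)$ the class of admissible controls and $\Omega\subset\mathbb{R}^m$ compact and convex with $0\in\mathrm{int}\,\Omega$. Let $\phi_{\tau,u}(g)$ denote the solution of $\Sigma$ at time $\tau$ with initial condition $g$ and control $u$. For $\tau>0$ put $\mathcal{A}_\tau=\{\phi_{\tau,u}(e):u\in\mathcal{U}\}$; the reachable set from the identity is $\mathcal{A}=\bigcup_{\tau>0}\mathcal{A}_\tau$. $\Sigma$ satisfies the rank-condition if the smallest Lie subalgebra of $\mathfrak{g}$ containing all $\mathcal{D}^i(X^j)$, $i\ge 0$, $j=1,\dots,m$, is $\mathfrak{g}$. A subset $C\subset G$ is $\varphi$-invariant if $\varphi_t(C)=C$ for all $t\in\mathbb{R}$. *)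

(* Defs.v *)
From HB Require Import structures.
From mathcomp Require Import all_boot all_order all_algebra.
From mathcomp Require Import all_classical all_reals all_analysis.

Set Implicit Arguments.
Unset Strict Implicit.
Unset Printing Implicit Defensive.

Import Order.TTheory GRing.Theory Num.Theory.
Import numFieldNormedType.Exports.

Local Open Scope classical_set_scope.
Local Open Scope ring_scope.

(* [Ck] and [smooth_on] are meant for open [U] and finite-dimensional [V]:
   a map is then C^(k+1) iff it is differentiable on [U] and each of its
   directional derivatives is C^k. *)
Fixpoint Ck (R : realType) (V W : normedModType R) (k : nat) (U : set V)
    (f : V -> W) : Prop :=
  if k is k'.+1 then
    (forall x, U x -> differentiable f x) /\
    (forall v, Ck k' U (fun x => 'D_v f x))
  else forall x, U x -> {for x, continuous f}.

Definition smooth_on (R : realType) (V W : normedModType R) (U : set V)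
    (f : V -> W) : Prop :=
  forall k, Ck k U f.

(* [chart_map] is only meaningful on [chart_dom], and [chart_inv] on
   [chart_map @` chart_dom]. *)
Record chart (R : realType) (n : nat) (M : topologicalType) := Chart {
  chart_dom : set M;
  chart_map :> M -> 'rV[R]_n;
  chart_inv : 'rV[R]_n -> M;
  chart_dom_open : open chart_dom;
  chart_img_open : open (chart_map @` chart_dom);
  chart_mapK : forall x, chart_dom x -> chart_inv (chart_map x) = x;
  chart_map_continuous :
    forall x, chart_dom x -> {for x, continuous chart_map};
  chart_inv_continuous :
    forall p, (chart_map @` chart_dom) p -> {for p, continuous chart_inv}
}.

Definition chart_img (R : realType) (n : nat) (M : topologicalType)
    (c : chart R n M) : set 'rV[R]_n :=
  c @` chart_dom c.

(* Smooth manifolds of dimension [n], without boundary.  The atlas is indexed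
   by the points of [M], so that each point [x] has a preferred chart
   [chart_at x] around it; tangent vectors at [x] are then represented by
   their coordinates in that chart, and the tangent space at every point is
   the type ['rV[R]_n]. *)
HB.mixin Record isManifold (R : realType) (n : nat) M of Topological M := {
  chart_at : M -> chart R n M;
  chart_atP : forall x, chart_dom (chart_at x) x;
  chart_compat : forall x y,
    smooth_on [set p | chart_img (chart_at x) p /\
                       chart_dom (chart_at y) (chart_inv (chart_at x) p)]
              (chart_at y \o chart_inv (chart_at x));
  manifold_hausdorff : hausdorff_space M;
  manifold_second_countable : @second_countable M
}.

#[short(type="manifoldType")]
HB.structure Definition Manifold (R : realType) (n : nat) :=
  {M of isManifold R n M & Topological M}.

Definition smooth_map (R : realType) (n : nat) (M N : manifoldType R n)
    (f : M -> N) : Prop :=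
  continuous f /\
  forall x y,
    smooth_on [set p | chart_img (chart_at x) p /\
                       chart_dom (chart_at y) (f (chart_inv (chart_at x) p))]
              (chart_at y \o f \o chart_inv (chart_at x)).

Definition tangent_map (R : realType) (n : nat) (M N : manifoldType R n)
    (f : M -> N) (x : M) : 'rV[R]_n -> 'rV[R]_n :=
  'd (chart_at (f x) \o f \o chart_inv (chart_at x)) (chart_at x x).

Definition vector_field (R : realType) (n : nat) (M : manifoldType R n) : Type :=
  M -> 'rV[R]_n.

(* Local representative of [X] in the chart [chart_at y]. *)
Definition vf_rep (R : realType) (n : nat) (M : manifoldType R n)
    (X : vector_field M) (y : M) : 'rV[R]_n -> 'rV[R]_n :=
  fun p => let x := chart_inv (chart_at y) p in
    'd (chart_at y \o chart_inv (chart_at x)) (chart_at x x) (X x).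

Definition smooth_vf (R : realType) (n : nat) (M : manifoldType R n)
    (X : vector_field M) : Prop :=
  forall y, smooth_on (chart_img (chart_at y)) (vf_rep X y).

(* The sign is the usual one: [X, Y] f = X (Y f) - Y (X f). *)
Definition lie_bracket (R : realType) (n : nat) (M : manifoldType R n)
    (X Y : vector_field M) : vector_field M :=
  fun x => 'd (vf_rep Y x) (chart_at x x) (X x)
         - 'd (vf_rep X x) (chart_at x x) (Y x).

(* Continuity is required because [chart_at (c t) \o c] is meaningless at the
   times at which [c] is outside the domain of the chart. *)
Definition has_velocity (R : realType) (n : nat) (M : manifoldType R n)
    (c : R -> M) (t : R) (v : 'rV[R]_n) : Prop :=
  {for t, continuous c} /\ is_derive t 1 (chart_at (c t) \o c) v.

Definition is_flow (R : realType) (n : nat) (M : manifoldType R n)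
    (X : vector_field M) (phi : R -> M -> M) : Prop :=
  [/\ forall x, phi 0 x = x,
      forall s t x, phi (s + t) x = phi s (phi t x) &
      forall t x, has_velocity (phi^~ x) t (X (phi t x))].

HB.mixin Record isLieGroup (R : realType) (n : nat) G
    of Manifold R n G & Group G := {
  lie_mul_continuous : continuous (fun p : G * G => (p.1 * p.2)%g);
  lie_mul_smooth : forall x y z : G,
    smooth_on
      [set p : 'rV[R]_n * 'rV[R]_n |
        [/\ chart_img (chart_at x) p.1, chart_img (chart_at y) p.2 &
            chart_dom (chart_at z)
              (chart_inv (chart_at x) p.1 * chart_inv (chart_at y) p.2)%g]]
      (fun p => chart_at z
              (chart_inv (chart_at x) p.1 * chart_inv (chart_at y) p.2)%g);
  lie_inv_smooth : smooth_map (fun x : G => (x^-1)%g)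
}.

#[short(type="lieGroupType")]
HB.structure Definition LieGroup (R : realType) (n : nat) :=
  {G of isLieGroup R n G & Manifold R n G & Group G}.

Definition lie_automorphism (R : realType) (n : nat) (G : lieGroupType R n)
    (f : G -> G) : Prop :=
  [/\ {morph f : x y / (x * y)%g}, smooth_map f &
      exists g : G -> G, [/\ cancel f g, cancel g f & smooth_map g]].

Definition linear_vf (R : realType) (n : nat) (G : lieGroupType R n)
    (X : vector_field G) (phi : R -> G -> G) : Prop :=
  [/\ smooth_vf X, is_flow X phi & forall t, lie_automorphism (phi t)].

Definition right_invariant (R : realType) (n : nat) (G : lieGroupType R n)
    (X : vector_field G) : Prop :=
  forall g h : G, X (g * h)%g = tangent_map (fun x => (x * h)%g) g (X g).

Definition lie_algebra (R : realType) (n : nat) (G : lieGroupType R n) :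
    set (vector_field G) :=
  [set X | smooth_vf X /\ right_invariant X].

Definition lie_subalgebra (R : realType) (n : nat) (G : lieGroupType R n)
    (h : set (vector_field G)) : Prop :=
  [/\ h `<=` @lie_algebra R n G,
      h (fun=> 0),
      forall X Y, h X -> h Y -> h (fun x => X x + Y x),
      forall (a : R) X, h X -> h (fun x => a *: X x) &
      forall X Y, h X -> h Y -> h (lie_bracket X Y)].

(* The behaviour of [D] outside [lie_algebra G] is irrelevant. *)
Definition is_derivation (R : realType) (n : nat) (G : lieGroupType R n)
    (D : vector_field G -> vector_field G) : Prop :=
  [/\ forall X, lie_algebra X -> lie_algebra (D X),
      forall X Y, lie_algebra X -> lie_algebra Y ->
        D (fun x => X x + Y x) = (fun x => D X x + D Y x),
      forall (a : R) X, lie_algebra X ->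
        D (fun x => a *: X x) = (fun x => a *: D X x) &
      forall X Y, lie_algebra X -> lie_algebra Y ->
        D (lie_bracket X Y) =
        (fun x => lie_bracket (D X) Y x + lie_bracket X (D Y) x)].

(* [(d phi_t)_e = e^(t D)] for all [t], under the identification of
   [lie_algebra G] with the tangent space at the identity [X |-> X 1]; the
   exponential is written as its power series.  This determines [D] on
   [lie_algebra G]. *)
Definition derivation_of_flow (R : realType) (n : nat) (G : lieGroupType R n)
    (phi : R -> G -> G) (D : vector_field G -> vector_field G) : Prop :=
  is_derivation D /\
  forall (t : R) X, lie_algebra X ->
    series (fun k => (t ^+ k / k`!%:R) *: iter k D X 1%g) @ \oo -->
      tangent_map (phi t) 1%g (X 1%g).

Record linear_control_system (R : realType) (n m : nat)
    (G : lieGroupType R n) := LinearControlSystem {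
  drift : vector_field G;
  flow : R -> G -> G;
  control_vf : 'I_m -> vector_field G;
  control_range : set 'rV[R]_m;
  drift_linear : linear_vf drift flow;
  control_vfP : forall j, lie_algebra (control_vf j);
  control_range_compact : compact control_range;
  control_range_convex :
    convex_set (control_range : set (convex_lmodType 'rV[R]_m));
  control_range_0 : interior control_range 0
}.

(* Representatives of the elements of L^oo(R, Omega); the sigma-algebra of
   [lebesgue_measure] consists of the Borel sets, so these representatives are
   Borel functions. *)
Definition admissible (R : realType) (m : nat) (Omega : set 'rV[R]_m)
    (u : R -> 'rV[R]_m) : Prop :=
  (forall j, (fun t => u t ord0 j) \in Lfun (@lebesgue_measure R) +oo%E) /\
  {ae (@lebesgue_measure R), forall t, Omega (u t)}.

Definition absolutely_continuous (R : realType) (V : normedModType R)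
    (a b : R) (f : R -> V) : Prop :=
  forall e : R, 0 < e -> exists2 d : R, 0 < d &
    forall (k : nat) (s t : 'I_k -> R),
      (forall i, a <= s i /\ s i <= t i /\ t i <= b) ->
      (forall i j, i != j -> t i <= s j \/ t j <= s i) ->
      \sum_i (t i - s i) < d -> \sum_i `|f (t i) - f (s i)| < e.

(* Solutions on [0, tau] in the sense of Caratheodory: the curve is absolutely
   continuous, read in charts, and satisfies the equation almost everywhere. *)
Definition solution (R : realType) (n m : nat) (G : lieGroupType R n)
    (S : linear_control_system m G) (u : R -> 'rV[R]_m) (tau : R)
    (c : R -> G) : Prop :=
  [/\ {within `[0, tau], continuous c},
      forall (x : G) (a b : R), 0 <= a -> a <= b -> b <= tau ->
        (forall t, a <= t <= b -> chart_dom (chart_at x) (c t)) ->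
        absolutely_continuous a b (chart_at x \o c) &
      {ae (@lebesgue_measure R), forall t, 0 < t < tau ->
        has_velocity c t
          (drift S (c t) + \sum_j u t ord0 j *: control_vf S j (c t))}].

Definition reachable_at (R : realType) (n m : nat) (G : lieGroupType R n)
    (S : linear_control_system m G) (tau : R) : set G :=
  [set x | exists (u : R -> 'rV[R]_m) (c : R -> G),
     [/\ admissible (control_range S) u, solution S u tau c,
         c 0 = 1%g & c tau = x]].

Definition reachable (R : realType) (n m : nat) (G : lieGroupType R n)
    (S : linear_control_system m G) : set G :=
  \bigcup_(tau in [set tau : R | 0 < tau]) reachable_at S tau.

Definition rank_condition (R : realType) (n m : nat) (G : lieGroupType R n)
    (S : linear_control_system m G)
    (D : vector_field G -> vector_field G) : Prop :=
  smallest (@lie_subalgebra R n G)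
    [set Y | exists i j, Y = iter i D (control_vf S j)] = @lie_algebra R n G.

Definition flow_invariant (R : realType) (T : Type) (phi : R -> T -> T)
    (C : set T) : Prop :=
  forall t, phi t @` C = C.

Definition reachable_core (R : realType) (n m : nat) (G : lieGroupType R n)
    (S : linear_control_system m G) : set G :=
  \bigcap_(t in [set: R]) (flow S t @` reachable S).

(* Main.v *)
Require Import Defs.
From HB Require Import structures.
From mathcomp Require Import all_boot all_order all_algebra.
From mathcomp Require Import all_classical all_reals all_analysis.
From mathcomp Require Import measurable_realfun ess_sup_inf lra.

(** The proof rests on one identity for linear control systems.  Let [c] be a
    solution from the identity for a control [u], and [z] a point.  Then
    [c t * flow S t z] is the solution from [z] for the same control: the
    control fields are right-invariant, so they only see the left factor, while
    the drift satisfies a product rule because its flow consists of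
    automorphisms.  This is [solution_mul_flow].

    Concatenating a path from the identity to [z] with such a curve
    ([solution_concat]) gives [reachable_mul_flow]: if [x] is reachable in
    time [tau] and [z] is reachable, then so is [x * flow S tau z].  The zero
    control reaches the identity in every time, so the reachable set is
    invariant under the drift in forward time ([reachable_flow]).

    The proposition follows from these two facts.  A point lies in the core iff
    its whole drift orbit is reachable ([reachable_coreP]), which makes the core
    the greatest invariant subset.  By forward invariance it suffices that the
    orbit is reachable at all sufficiently negative times
    ([reachable_core_past]).  Finally, if [x] and [y] are in the core and
    [flow S t x] is reached in time [tau], then [flow S t y] is
    [flow S tau z] with [z] on the orbit of [y], hence reachable, so
    [flow S t (x * y) = flow S t x * flow S tau z] is reachable.

    Most of the work is to verify that the curves so built are solutions in the
    sense of Caratheodory.  The velocity is a matter of the chain rule in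
    charts.  Absolute continuity in charts is transported through the
    multiplication, which is locally Lipschitz since it is C^1
    ([C1_lipschitz]); it is preserved by gluing, and can be tested locally
    ([absolutely_continuous_glue], [absolutely_continuous_local]). *)

Set Implicit Arguments.
Unset Strict Implicit.
Unset Printing Implicit Defensive.

Import Order.TTheory GRing.Theory Num.Theory.
Import numFieldNormedType.Exports.

Local Open Scope classical_set_scope.
Local Open Scope ring_scope.

(** * Absolutely continuous curves *)

Section AbsoluteContinuity.
Context {R : realType}.
Implicit Types (a b : R).

Lemma absolutely_continuous_sub (V : normedModType R) a b a' b' (f : R -> V) :
  a <= a' -> b' <= b ->
  absolutely_continuous a b f -> absolutely_continuous a' b' f.
Proof.
move=> aa' bb' fac e /fac[d d0 fd]; exists d => // k s t st.
by apply: fd => i; have [? [? ?]] := st i; lra.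
Qed.

(** The form in which absolute continuity is transported: the increments of [h]
    are controlled by those of [f] and [g] together, as happens when [h] is a
    Lipschitz function of the pair [(f, g)]. *)
Lemma absolutely_continuous_le (U V W : normedModType R) a b
    (f : R -> U) (g : R -> V) (h : R -> W) (L : R) :
  (forall s t, a <= s <= b -> a <= t <= b ->
     `|h t - h s| <= L * (`|f t - f s| + `|g t - g s|)) ->
  absolutely_continuous a b f -> absolutely_continuous a b g ->
  absolutely_continuous a b h.
Proof.
move=> hL fac gac e e0.
have L0 : 0 < `|L| + 1 by rewrite ltr_wpDl.
have e0' : 0 < e / (`|L| + 1) / 2 by rewrite !divr_gt0.
have [d1 d10 fd] := fac _ e0'; have [d2 d20 gd] := gac _ e0'.
exists (Num.min d1 d2); first by rewrite lt_min d10.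
move=> k s t st disj; rewrite lt_min => /andP[sd1 sd2].
have {fd sd1} := fd k s t st disj sd1; have {gd sd2} := gd k s t st disj sd2.
move=> gsum fsum.
have : \sum_i `|h (t i) - h (s i)| <=
    (`|L| + 1) * (\sum_i `|f (t i) - f (s i)| + \sum_i `|g (t i) - g (s i)|).
  rewrite -big_split mulr_sumr; apply: ler_sum => i _.
  have [? [? ?]] := st i.
  apply: (le_trans (hL _ _ _ _)); [lra|lra|].
  by rewrite ler_wpM2r ?addr_ge0// (le_trans (ler_norm _))// lerDl.
move=> /le_lt_trans; apply; rewrite -ltr_pdivlMl// mulrC; lra.
Qed.

Lemma absolutely_continuous_lip (V : normedModType R) a b (f : R -> V) (L : R) :
  (forall s t, a <= s <= b -> a <= t <= b -> `|f t - f s| <= L * `|t - s|) ->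
  absolutely_continuous a b f.
Proof.
move=> fL; suff idac : absolutely_continuous a b (id : R -> R^o).
  apply: (@absolutely_continuous_le R^o R^o _ a b id id f `|L|) => // s t sab tab.
  apply: (le_trans (fL _ _ sab tab)).
  apply: (@le_trans _ _ (`|L| * `|t - s|)).
    by rewrite ler_wpM2r// ler_norm.
  by rewrite ler_wpM2l// lerDl.
move=> e e0; exists e => // k s t st _; apply: le_lt_trans.
apply: ler_sum => i _; have [? [? ?]] := st i.
by rewrite ger0_norm// subr_ge0.
Qed.

(** Each interval of a test family is cut at [c] by truncating both of its
    endpoints, from above on one side and from below on the other.  Truncation
    is monotone, so both families are again non-overlapping and no case analysis
    on the position of the intervals is needed; an interval on one side of [c]
    degenerates to the point [c] on the other. *)
Lemma absolutely_continuous_glue (V : normedModType R) a c b (f : R -> V) :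
  a <= c -> c <= b ->
  absolutely_continuous a c f -> absolutely_continuous c b f ->
  absolutely_continuous a b f.
Proof.
move=> ac cb fac fcb e e0.
have e20 : 0 < e / 2 by rewrite divr_gt0.
have [d1 d10 fd1] := fac _ e20; have [d2 d20 fd2] := fcb _ e20.
exists (Num.min d1 d2); first by rewrite lt_min d10.
move=> k s t st disj; rewrite lt_min => /andP[sd1 sd2].
pose lo (x : R) := Num.min x c; pose hi (x : R) := Num.max x c.
have split_len i : lo (t i) - lo (s i) + (hi (t i) - hi (s i)) = t i - s i.
  by rewrite /lo /hi addrACA -opprD !addr_min_max opprD; lra.
have ge0lo i : 0 <= lo (t i) - lo (s i).
  have [? [? ?]] := st i; rewrite subr_ge0 /lo.
  by rewrite le_min !ge_min lexx orbT andbT; apply/orP; left.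
have ge0hi i : 0 <= hi (t i) - hi (s i).
  have [? [? ?]] := st i; rewrite subr_ge0 /hi.
  by rewrite ge_max !le_max lexx orbT andbT; apply/orP; left.
have lo_lt : \sum_i `|f (lo (t i)) - f (lo (s i))| < e / 2.
  apply: (fd1 k (lo \o s) (lo \o t)) => /=.
  - move=> i; have [? [? ?]] := st i; rewrite /lo.
    by case: (leP (s i) c) => ?; case: (leP (t i) c) => ?; lra.
  - move=> i j /disj[] ij; [left|right];
      by rewrite /lo le_min !ge_min lexx orbT andbT; apply/orP; left.
  - apply: le_lt_trans sd1; apply: ler_sum => i _; rewrite -split_len.
    by rewrite lerDl.
have hi_lt : \sum_i `|f (hi (t i)) - f (hi (s i))| < e / 2.
  apply: (fd2 k (hi \o s) (hi \o t)) => /=.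
  - move=> i; have [? [? ?]] := st i; rewrite /hi.
    by case: (leP (s i) c) => ?; case: (leP (t i) c) => ?; lra.
  - move=> i j /disj[] ij; [left|right];
      by rewrite /hi ge_max !le_max lexx orbT andbT; apply/orP; left.
  - apply: le_lt_trans sd2; apply: ler_sum => i _; rewrite -split_len.
    by rewrite lerDr.
rewrite [ltRHS]splitr; apply: le_lt_trans (ltrD lo_lt hi_lt).
rewrite -big_split; apply: ler_sum => i _ /=.
have split_f x : f (lo x) + f (hi x) = f x + f c.
  rewrite /lo /hi; case: (leP x c) => // _; exact: addrC.
have -> : f (t i) - f (s i) =
    f (lo (t i)) - f (lo (s i)) + (f (hi (t i)) - f (hi (s i))).
  by rewrite addrACA -opprD !split_f opprD addrACA subrr addr0.
exact: ler_normD.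
Qed.

Lemma absolutely_continuous_degenerate (V : normedModType R) a b (f : R -> V) :
  b <= a -> absolutely_continuous a b f.
Proof.
move=> ba; apply: (@absolutely_continuous_lip _ _ _ _ 0) => s t sab tab.
by have -> : s = t by [lra]; rewrite subrr normr0 mul0r.
Qed.

(** Absolute continuity may be checked near each point, although its definition
    is global: by gluing, the supremum of the [t] up to which [f] is absolutely
    continuous cannot be less than [b]. *)
Lemma absolutely_continuous_local (V : normedModType R) a b (f : R -> V) :
  (forall t, a <= t <= b -> exists2 d : R, 0 < d &
     absolutely_continuous (Num.max a (t - d)) (Num.min b (t + d)) f) ->
  absolutely_continuous a b f.
Proof.
move=> floc; have [ba|/ltW ab] := leP b a.
  exact: absolutely_continuous_degenerate.
pose E := [set t | a <= t <= b /\ absolutely_continuous a t f].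
have Ea : E a by split; [rewrite lexx|exact: absolutely_continuous_degenerate].
have supE : has_sup E by split; [exists a|exists b => t [/andP[]]].
have asup : a <= sup E by apply: ub_le_sup => //; exact: supE.2.
have supb : sup E <= b by apply: ge_sup; [exists a|move=> t [/andP[]]].
have [|d d0 fd] := floc (sup E); first by apply/andP.
have [t [tab fat] dt] := sup_adherent d0 supE.
have tsup : t <= sup E by apply: ub_le_sup => //; exact: supE.2.
pose t' := Num.min b (sup E + d).
have tt' : t <= t' by rewrite /t' le_min; apply/andP; split; lra.
have Et' : absolutely_continuous a t' f.
  apply: (@absolutely_continuous_glue _ _ t) => //; first lra.
  apply: absolutely_continuous_sub fd => //.
  by rewrite ge_max; apply/andP; split; lra.
have : t' <= sup E.
  apply: ub_le_sup; first exact: supE.2.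
  by split=> //; rewrite /t' ge_min lexx /= andbT -/t'; lra.
rewrite /t'; case: (leP b (sup E + d)) => ? bs; last lra.
by move: Et'; rewrite /t' min_l.
Qed.

Lemma absolutely_continuous_eq (V : normedModType R) a b (f g : R -> V) :
  (forall t, a <= t <= b -> f t = g t) ->
  absolutely_continuous a b f -> absolutely_continuous a b g.
Proof.
move=> fg fac; apply: (@absolutely_continuous_le _ _ _ _ _ f f g 1) => // s t sab tab.
by rewrite mul1r !fg// lerDl.
Qed.

Lemma absolutely_continuous_shift (V : normedModType R) a b c (f : R -> V) :
  absolutely_continuous a b f ->
  absolutely_continuous (a + c) (b + c) (fun t => f (t - c)).
Proof.
move=> fac e /fac[d d0 fd]; exists d => // k s t st disj std.
apply: (fd k (fun i => s i - c) (fun i => t i - c)).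
- by move=> i; have [? [? ?]] := st i; lra.
- by move=> i j /disj; rewrite !lerD2r.
- by under eq_bigr do rewrite opprB addrA subrK.
Qed.

End AbsoluteContinuity.

(** * Null sets under time shifts, and essentially bounded functions *)

Section LebesgueTranslation.
Context {R : realType}.
Local Notation mu := (@lebesgue_measure R).

#[global] Instance lebesgue_ae_filter : Filter (almost_everywhere mu).
Proof. exact: ae_filter_ringOfSetsType. Qed.

Lemma measurable_shift (c : R) :
  measurable_fun [set: measurableTypeR R] (fun t : R => t - c).
Proof.
apply: continuous_measurable_fun => t.
by apply: continuousB; [exact: cvg_id|exact: cvg_cst].
Qed.

(** Lebesgue measure is determined by its values on the intervals [`]a, b]],
    whose length does not change under translation. *)
Lemma lebesgue_measure_shift (c : R) (A : set R) : measurable A ->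
  pushforward mu (fun t : measurableTypeR R => t - c : measurableTypeR R) A
    = mu A.
Proof.
have ms := measurable_shift c.
move=> mA; apply/esym/lebesgue_measure_unique => //= _ [[a b]] _ <-.
rewrite /pushforward /=.
have -> : (fun t => t - c) @^-1` `]a, b] = `]a + c, b + c]%classic :> set R.
  by apply/seteqP; split=> t /=; rewrite !in_itv /= ltrBrDr lerBlDr.
rewrite !lebesgue_measure_itv /= !lte_fin ltrD2r -!EFinB.
by rewrite opprD addrACA subrr addr0.
Qed.

Lemma ae_shift (c : R) (P : R -> Prop) :
  {ae mu, forall t, P t} -> {ae mu, forall t, P (t - c)}.
Proof.
move=> [A [mA A0 PA]]; exists ((fun t => t - c) @^-1` A); split.
- by rewrite -[X in measurable X]setTI; exact: measurable_shift.
- by rewrite -[RHS]A0 -(lebesgue_measure_shift c mA).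
- by move=> t nPt; exact: PA.
Qed.

(** The values of a control lie in a bounded set, so this leaves only the
    measurability of controls to be checked. *)
Lemma Lfun_pinfty_ae_bounded (f : R -> R) (M : R) :
  measurable_fun setT f -> {ae mu, forall t, `|f t| <= M} ->
  f \in Lfun mu +oo%E.
Proof.
move=> mf fM; rewrite inE; apply/andP; split; first by rewrite inE.
rewrite inE /= /finite_norm unlock; case: ifPn => // _.
apply: (@le_lt_trans _ _ M%:E); last exact: ltry.
by apply/ess_supP; move: fM; apply: filterS => t; rewrite /= lee_fin.
Qed.

Lemma Lfun_measurable (f : R -> R) : f \in Lfun mu +oo%E -> measurable_fun setT f.
Proof. by move=> /sub_Lfun_mfun; rewrite inE. Qed.
End LebesgueTranslation.

(** * Calculus in coordinate spaces *)

Section Calculus.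
Context {R : realType}.

Lemma coord_le_norm n (v : 'rV[R]_n) j : `|v ord0 j| <= `|v|.
Proof.
rewrite [leRHS]/Num.Def.normr /= mx_normrE.
by rewrite (le_bigmax _ (fun i : 'I_1 * 'I_n => `|v i.1 i.2|) (ord0, j)).
Qed.

Lemma norm_le_coord n (v : 'rV[R]_n) (M : R) : 0 <= M ->
  (forall j, `|v ord0 j| <= M) -> `|v| <= M.
Proof.
move=> M0 vM; rewrite /Num.Def.normr /= mx_normrE bigmax_le// => -[i j] _ /=.
by rewrite (ord1 i).
Qed.

Lemma is_derive_diff_comp (V W : normedModType R) (F : V -> W) (g : R -> V)
    (t : R) (v : V) :
  differentiable F (g t) -> is_derive t 1 g v ->
  is_derive t 1 (F \o g) ('d F (g t) v).
Proof.
move=> dF [/derivable1_diffP dg gv].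
apply: DeriveDef.
  by apply/derivable1_diffP; exact: differentiable_comp.
rewrite deriveE; last exact: differentiable_comp.
by rewrite diff_comp//=; congr ('d F _ _); rewrite -deriveE.
Qed.

Lemma is_derive_pair (V W : normedModType R) (f : R -> V) (g : R -> W)
    (t : R) (v : V) (w : W) :
  is_derive t 1 f v -> is_derive t 1 g w ->
  is_derive t 1 (fun s => (f s, g s)) (v, w).
Proof.
move=> [/derivable1_diffP df fv] [/derivable1_diffP dg gw].
apply: DeriveDef.
  by apply/derivable1_diffP; exact: differentiable_pair.
rewrite deriveE; last exact: differentiable_pair.
by rewrite diff_pair//=; congr (_, _); rewrite -deriveE.
Qed.

Lemma is_derive_line (V : normedModType R) (p h : V) (s : R) :
  is_derive s 1 (fun s => p + s *: h) h.
Proof.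
have [dl dlE] : is_diff s (cst p + ( *:%R^~ h)) (0 + ( *:%R^~ h)).
  exact: is_diffD.
apply: DeriveDef; first exact/derivable1_diffP.
by rewrite deriveE// [X in X = _](congr1 (@^~ 1) dlE) /= fctE add0r scale1r.
Qed.

(** The norm on row vectors is the maximum of the coordinates, so the mean value
    theorem for real functions applies one coordinate at a time and keeps the
    constant [M]. *)
Lemma curve_mean_value n (g dg : R -> 'rV[R]_n) (a b M : R) : a <= b ->
  (forall s, a <= s <= b -> is_derive s 1 g (dg s)) ->
  (forall s, a <= s <= b -> `|dg s| <= M) ->
  `|g b - g a| <= M * (b - a).
Proof.
move=> ab gd dgM.
have M0 : 0 <= M by apply: (le_trans (normr_ge0 (dg a))); apply: dgM; rewrite lexx.
apply: norm_le_coord => [|j]; first by rewrite mulr_ge0// subr_ge0.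
have gjd s : a <= s <= b -> is_derive s 1 (fun s => g s ord0 j : R) (dg s ord0 j).
  move=> /gd[gs gsE]; apply: DeriveDef; first exact: ((derivable_mxP _ _ _).1 gs).
  by rewrite -gsE derive_mx// mxE.
have [c cab] : exists2 c, c \in `[a, b]%R &
    g b ord0 j - g a ord0 j = dg c ord0 j * (b - a).
  apply: (@MVT_segment _ (fun s => g s ord0 j) (fun s => dg s ord0 j) _ _ ab) => [s|].
    by rewrite in_itv /= => /andP[/ltW ? /ltW ?]; apply: gjd; apply/andP.
  apply: derivable_within_continuous => s; rewrite in_itv /= => /gjd[].
  by [].
rewrite !mxE => ->; rewrite normrM [`|b - a|]ger0_norm ?subr_ge0//.
rewrite ler_wpM2r ?subr_ge0//; apply: (le_trans (coord_le_norm _ _)).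
by apply: dgM; rewrite in_itv in cab.
Qed.

Lemma curve_lipschitz n (g dg : R -> 'rV[R]_n) (t d M : R) :
  (forall s, `|s - t| < d -> is_derive s 1 g (dg s)) ->
  (forall s, `|s - t| < d -> `|dg s| <= M) ->
  forall s s', `|s - t| < d -> `|s' - t| < d ->
    `|g s' - g s| <= M * `|s' - s|.
Proof.
move=> gd dgM s s'; wlog ss' : s s' / s <= s' => [H|] sd s'd.
  have [ss'|/ltW s's] := leP s s'; first exact: H.
  by rewrite distrC [`|s' - s|]distrC H.
rewrite [`|s' - s|]ger0_norm ?subr_ge0//; move: sd s'd.
rewrite !ltr_norml => /andP[? ?] /andP[? ?].
apply: (@curve_mean_value _ g dg) => // r /andP[? ?].
  by apply: gd; rewrite ltr_norml; apply/andP; split; lra.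
by apply: dgM; rewrite ltr_norml; apply/andP; split; lra.
Qed.

(** The operator norm is bounded through the images of the basis vectors, because
    [Ck] gives the continuity of the derivative one direction at a time. *)
Lemma linear_pair_bound n1 n2 (W : normedModType R)
    (l : {linear ('rV[R]_n1 * 'rV[R]_n2)%type -> W}) (M : R) :
  (forall i, `|l (delta_mx 0 i, 0)| <= M) ->
  (forall i, `|l (0, delta_mx 0 i)| <= M) ->
  forall h, `|l h| <= (M *+ n1 + M *+ n2) * `|h|.
Proof.
move=> M1 M2 [h1 h2].
have coordE k (g : 'rV[R]_k -> 'rV[R]_n1 * 'rV[R]_n2) (v : 'rV[R]_k) :
    {morph g : x y / x + y} -> g 0 = 0 -> (forall a x, g (a *: x) = a *: g x) ->
    (forall i, `|l (g (delta_mx 0 i))| <= M) -> `|l (g v)| <= M *+ k * `|v|.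
  move=> gD g0 gZ gM.
  have -> : g v = \sum_i v 0 i *: g (delta_mx 0 i).
    rewrite {1}(row_sum_delta v) (big_morph g gD g0).
    by apply: eq_bigr => i _; exact: gZ.
  rewrite linear_sum; apply: (le_trans (ler_norm_sum _ _ _)).
  have -> : M *+ k * `|v| = \sum_(i < k) M * `|v|.
    by rewrite sumr_const card_ord mulrnAl.
  apply: ler_sum => i _.
  by rewrite linearZ normrZ mulrC ler_pM// coord_le_norm.
have hE : (h1, h2) = (h1, 0) + (0, h2) :> 'rV[R]_n1 * 'rV[R]_n2.
  by congr (_, _); rewrite ?addr0 ?add0r.
rewrite [in leLHS]hE linearD mulrDl; apply: (le_trans (ler_normD _ _)).
have h1le : `|h1| <= `|(h1, h2) : 'rV[R]_n1 * 'rV[R]_n2|.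
  by rewrite prod_normE le_max lexx.
have h2le : `|h2| <= `|(h1, h2) : 'rV[R]_n1 * 'rV[R]_n2|.
  by rewrite prod_normE le_max lexx orbT.
have Mge0 k (v : 'I_k -> 'rV[R]_n1 * 'rV[R]_n2) :
    (forall i, `|l (v i)| <= M) -> 0 <= M *+ k.
  case: k v => [|k] v vM; first by rewrite mulr0n.
  by rewrite mulrn_wge0// (le_trans _ (vM ord0)).
apply: lerD.
  apply: (@le_trans _ _ (M *+ n1 * `|h1|)); last first.
    by apply: ler_wpM2l => //; exact: Mge0 M1.
  apply: (coordE _ (fun v => (v, 0))) => // [x y|a x]; congr (_, _).
    by rewrite addr0.
  by rewrite scaler0.
apply: (@le_trans _ _ (M *+ n2 * `|h2|)); last first.
    by apply: ler_wpM2l => //; exact: Mge0 M2.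
apply: (coordE _ (fun v => (0, v))) => // [x y|a x]; congr (_, _).
  by rewrite addr0.
by rewrite scaler0.
Qed.

(** A C^1 map is locally Lipschitz: the partial derivatives are bounded near [p0]
    by continuity, hence so is the differential, and the mean value inequality
    applies along the segment from [p] to [q], which stays in the ball around
    [p0].  The source is a product because the map of interest is group
    multiplication. *)
Lemma C1_lipschitz n1 n2 n (U : set ('rV[R]_n1 * 'rV[R]_n2))
    (F : 'rV[R]_n1 * 'rV[R]_n2 -> 'rV[R]_n)
    (p0 : 'rV[R]_n1 * 'rV[R]_n2) :
  Ck 1 U F -> nbhs p0 U ->
  exists2 d : R, 0 < d & exists L : R,
    forall p q : 'rV[R]_n1 * 'rV[R]_n2,
    `|p - p0| < d -> `|q - p0| < d -> `|F q - F p| <= L * `|q - p|.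
Proof.
move=> [dF cF] Up0.
have near_bound k (v : 'I_k -> 'rV[R]_n1 * 'rV[R]_n2) :
    exists M, \forall p \near p0, forall i, `|'D_(v i) F p| <= M.
  exists (\sum_i (`|'D_(v i) F p0| + 1)).
  apply: (@filter_forall _ _ (fun i p => is_true
    (`|'D_(v i) F p| <= \sum_i (`|'D_(v i) F p0| + 1))) (nbhs p0)) => i.
  have : {for p0, continuous ('D_(v i) F)} by apply: cF; exact: nbhs_singleton.
  move=> /cvgrPdist_le /(_ 1 ltr01); apply: filterS => p vp.
  rewrite (bigD1 i)//=; apply: (@le_trans _ _ (`|'D_(v i) F p0| + 1)).
    rewrite -lerBlDl; apply: (le_trans _ vp).
    by rewrite distrC lerB_dist.
  by rewrite lerDl sumr_ge0// => j _; rewrite addr_ge0.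
have [M1 FM1] := near_bound _ (fun i => (delta_mx 0 i, 0)).
have [M2 FM2] := near_bound _ (fun i => (0, delta_mx 0 i)).
have : \forall p \near p0, [/\ U p,
  forall i, `|'D_(delta_mx 0 i, 0) F p| <= Num.max M1 M2 &
  forall i, `|'D_(0, delta_mx 0 i) F p| <= Num.max M1 M2].
  near=> p; split; first by near: p.
  - by move=> i; rewrite le_max; apply/orP; left; move: i; near: p.
  - by move=> i; rewrite le_max; apply/orP; right; move: i; near: p.
rewrite -nbhs_nearE => /nbhs_ballP[d /= d0 dF'].
set M := Num.max M1 M2 in dF'.
exists d => //; exists (M *+ n1 + M *+ n2) => p q pd qd.
pose g (s : R) := F (p + s *: (q - p)).
have inball s : 0 <= s <= 1 -> ball p0 d (p + s *: (q - p)).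
  move=> /andP[s0 s1]; rewrite -ball_normE /= distrC.
  have -> : p + s *: (q - p) - p0 = (1 - s) *: (p - p0) + s *: (q - p0).
    rewrite scalerBl scale1r -[RHS]addrA [- _ + _ in RHS]addrC.
    by rewrite -scalerBr opprB addrA subrK addrAC.
  apply: (le_lt_trans (ler_normD _ _)); rewrite !normrZ !ger0_norm ?subr_ge0//.
  have [->|sn0] := eqVneq s 0; first by rewrite subr0 mul1r mul0r addr0.
  have spos : 0 < s by rewrite lt0r sn0.
  apply: (@lt_le_trans _ _ ((1 - s) * d + s * d)); last lra.
  by apply: ler_ltD; [rewrite ler_wpM2l ?subr_ge0// ltW|rewrite ltr_pM2l].
have gd (s : R) : 0 <= s <= 1 -> is_derive s 1 g ('d F (p + s *: (q - p)) (q - p)).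
  move=> /inball/dF'[Ups _ _].
  apply: (@is_derive_diff_comp _ _ F (fun s => p + s *: (q - p))); first exact: dF.
  exact: is_derive_line.
have := @curve_mean_value _ g _ 0 1 ((M *+ n1 + M *+ n2) * `|q - p|) ler01 gd.
rewrite /g scale1r scale0r addr0 subr0 mulr1 [p + (q - p)]addrC subrK; apply.
move=> s /inball/dF'[Ups b1 b2].
by apply: linear_pair_bound => i; rewrite -deriveE//; exact: dF.
Unshelve. all: by end_near. Qed.
End Calculus.

(** * Curves on a manifold, read in charts *)

Section Charts.
Context {R : realType} {n : nat}.

Lemma nbhs_chart_dom (M : topologicalType) (c : chart R n M) x :
  chart_dom c x -> nbhs x (chart_dom c).
Proof. by move=> cx; apply: open_nbhs_nbhs; split=> //; exact: chart_dom_open. Qed.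

Lemma chart_img_mem (M : topologicalType) (c : chart R n M) x :
  chart_dom c x -> chart_img c (c x).
Proof. by move=> cx; exists x. Qed.

Lemma nbhs_chart_img (M : topologicalType) (c : chart R n M) x :
  chart_dom c x -> nbhs (c x) (chart_img c).
Proof.
move=> cx; apply: open_nbhs_nbhs; split; first exact: chart_img_open.
exact: chart_img_mem.
Qed.

Lemma chart_inv_cvg (M : topologicalType) (c : chart R n M) x :
  chart_dom c x -> chart_inv c @ nbhs (c x) --> x.
Proof.
move=> cx; rewrite -[X in _ --> X](chart_mapK cx).
exact/chart_inv_continuous/chart_img_mem.
Qed.

Context {M : manifoldType R n}.
Implicit Types (c : R -> M) (x y z : M).

Lemma differentiable_transition x y z :
  chart_dom (chart_at x) z -> chart_dom (chart_at y) z ->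
  differentiable (chart_at y \o chart_inv (chart_at x)) (chart_at x z).
Proof.
move=> xz yz; have [+ _] := chart_compat x y 1; apply.
by split; [exact: chart_img_mem|rewrite /= chart_mapK].
Qed.

Lemma near_chart (T : Type) (F : set_system T) {FF : Filter F} (f : T -> M) x
    (d : R) : 0 < d -> f @ F --> x ->
  \forall s \near F, chart_dom (chart_at x) (f s) /\
    `|chart_at x (f s) - chart_at x x| < d.
Proof.
move=> d0 fx; have xx := chart_atP x.
have cfx : (chart_at x \o f) @ F --> chart_at x x.
  by apply: cvg_comp fx _; exact: (chart_map_continuous xx).
near=> s; split; near: s.
  exact: (fx _ (nbhs_chart_dom xx)).
exact: (cvgr_distC_lt _ _ cfx _ d0).
Unshelve. all: by end_near. Qed.

Lemma near_eq_has_velocity c c' t v : (\forall s \near t, c s = c' s) ->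
  has_velocity c t v -> has_velocity c' t v.
Proof.
move=> cc' [ct cv]; have ctE := nbhs_singleton cc'; split.
  change (c' @ t --> c' t); rewrite -ctE; apply: cvg_trans ct.
  by apply: near_eq_cvg; apply: filterS cc' => s ->.
rewrite -ctE; apply: near_eq_is_derive cv.
by apply: filterS cc' => s /= ->.
Qed.

Lemma has_velocity_shift c t a v : has_velocity c (t - a) v ->
  has_velocity (fun s => c (s - a)) t v.
Proof.
move=> [ct cv].
have sD : is_derive t 1 (fun s : R => s - a) 1.
  exact: (@is_derive_shift R t 1 (- a)).
split.
  apply: (@continuous_comp _ _ _ (fun s : R => s - a) c) => //.
  by apply: differentiable_continuous; apply/derivable1_diffP; case: sD.
have [/derivable1_diffP dc dcE] := cv.
have := @is_derive_diff_comp R R^o _ (chart_at (c (t - a)) \o c)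
  (fun s : R => s - a) t 1 dc sD.
by rewrite -deriveE// dcE.
Qed.

Lemma has_velocity_cst x t : has_velocity (fun=> x) t 0.
Proof. by split; [exact: cvg_cst|exact: is_derive_cst]. Qed.

Lemma has_velocity_unique c t v w :
  has_velocity c t v -> has_velocity c t w -> v = w.
Proof. by move=> [_ [_ <-]] [_ [_ <-]]. Qed.

(** The velocity of [c] is expressed in the preferred chart at [c t], which
    changes with [t]; to differentiate [c] on an interval one fixes a chart
    [chart_at y] and transports the velocity by the differential of the chart
    change. *)
Lemma has_velocity_chart c t v y :
  has_velocity c t v -> chart_dom (chart_at y) (c t) ->
  is_derive t 1 (chart_at y \o c)
    ('d (chart_at y \o chart_inv (chart_at (c t))) (chart_at (c t) (c t)) v).
Proof.
move=> [ct cv] yct.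
have ctd := chart_atP (c t).
have dT := differentiable_transition ctd yct.
have Tcv := is_derive_diff_comp (g := chart_at (c t) \o c) dT cv.
apply: (@near_eq_is_derive _ _ _ _ _ _ _ _ _ Tcv).
near=> s; rewrite /= chart_mapK//; near: s.
exact: (ct _ (nbhs_chart_dom ctd)).
Unshelve. all: by end_near. Qed.

Lemma vf_rep_chart (X : vector_field M) y z : chart_dom (chart_at y) z ->
  vf_rep X y (chart_at y z) =
  'd (chart_at y \o chart_inv (chart_at z)) (chart_at z z) (X z).
Proof. by move=> yz; rewrite /vf_rep /= chart_mapK. Qed.

(** In a fixed chart the derivative of an integral curve is the local
    representative of [X] along the curve; this is continuous, hence bounded near
    [t], and the mean value inequality makes the curve Lipschitz there. *)
Lemma integral_curve_lipschitz (X : vector_field M) c t :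
  smooth_vf X -> (forall s, has_velocity c s (X (c s))) ->
  exists2 d : R, 0 < d & exists L : R, forall s s',
    `|s - t| < d -> `|s' - t| < d ->
    `|chart_at (c t) (c s') - chart_at (c t) (c s)| <= L * `|s' - s|.
Proof.
move=> sX cX; set y := c t; set f := chart_at y \o c.
have yt : chart_dom (chart_at y) (c t) by exact: chart_atP.
have [ct _] := cX t.
have : {for t, continuous (fun s => vf_rep X y (f s))}.
  apply: (@continuous_comp _ _ _ f (vf_rep X y)).
    by apply: continuous_comp => //; exact: chart_map_continuous.
  by apply: (sX y 0); exact: chart_img_mem.
move=> /cvgrPdist_le/(_ 1 ltr01) repnear.
have : \forall s \near t, chart_dom (chart_at y) (c s) /\
    `|vf_rep X y (f s)| <= `|vf_rep X y (f t)| + 1.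
  near=> s; split.
    by near: s; exact: (ct _ (nbhs_chart_dom yt)).
  rewrite -lerBlDl (le_trans (lerB_dist _ _))// distrC.
  by near: s.
move=> /nbhs_ballP[d /= d0 near_t]; exists d => //.
have inball s : `|s - t| < d -> ball t d s by rewrite -ball_normE /= distrC.
exists (`|vf_rep X y (f t)| + 1).
apply: (@curve_lipschitz _ _ f (fun s => vf_rep X y (f s))) => s /inball/near_t[ys //].
by move=> _; rewrite vf_rep_chart//; exact: has_velocity_chart.
Unshelve. all: by end_near. Qed.

End Charts.

(** * Differentiating the group multiplication *)

Section Multiplication.
Context {R : realType} {n : nat} {G : lieGroupType R n}.
Implicit Types (x y z a b : G).

Lemma lie_mul_cvg (T : Type) (F : set_system T) (f g : T -> G) a b :
  Filter F -> f @ F --> a -> g @ F --> b -> (fun t => f t * g t)%g @ F --> (a * b)%g.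
Proof.
move=> FF fa gb.
exact: (continuous2_cvg _ (h := fun x y : G => (x * y)%g)
  (lie_mul_continuous (a, b)) fa gb).
Qed.

Definition mul_chart x y z (p : 'rV[R]_n * 'rV[R]_n) : 'rV[R]_n :=
  chart_at z (chart_inv (chart_at x) p.1 * chart_inv (chart_at y) p.2)%g.

Definition mul_chart_dom x y z : set ('rV[R]_n * 'rV[R]_n) :=
  [set p | [/\ chart_img (chart_at x) p.1, chart_img (chart_at y) p.2 &
    chart_dom (chart_at z)
      (chart_inv (chart_at x) p.1 * chart_inv (chart_at y) p.2)%g]].

Lemma mul_chartE x y z a b :
  chart_dom (chart_at x) a -> chart_dom (chart_at y) b ->
  mul_chart x y z (chart_at x a, chart_at y b) = chart_at z (a * b)%g.
Proof. by move=> xa yb; rewrite /mul_chart /= !chart_mapK. Qed.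

Lemma nbhs_mul_chart_dom x y z a b :
  chart_dom (chart_at x) a -> chart_dom (chart_at y) b ->
  chart_dom (chart_at z) (a * b)%g ->
  nbhs (chart_at x a, chart_at y b) (mul_chart_dom x y z).
Proof.
move=> xa yb zab.
have fst_cvg : (fun p => p.1) @ nbhs (chart_at x a, chart_at y b) --> chart_at x a
  by exact: cvg_fst.
have snd_cvg : (fun p => p.2) @ nbhs (chart_at x a, chart_at y b) --> chart_at y b
  by exact: cvg_snd.
have mul_cvg : (fun p => chart_inv (chart_at x) p.1 * chart_inv (chart_at y) p.2)%g
    @ nbhs (chart_at x a, chart_at y b) --> (a * b)%g.
  apply: lie_mul_cvg.
    by apply: cvg_comp fst_cvg _; exact: chart_inv_cvg.
  by apply: cvg_comp snd_cvg _; exact: chart_inv_cvg.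
near=> p; split; near: p.
- exact: (fst_cvg _ (nbhs_chart_img xa)).
- exact: (snd_cvg _ (nbhs_chart_img yb)).
- exact: (mul_cvg _ (nbhs_chart_dom zab)).
Unshelve. all: by end_near. Qed.

Lemma differentiable_mul_chart x y z a b :
  chart_dom (chart_at x) a -> chart_dom (chart_at y) b ->
  chart_dom (chart_at z) (a * b)%g ->
  differentiable (mul_chart x y z) (chart_at x a, chart_at y b).
Proof.
move=> xa yb zab; have [+ _] := lie_mul_smooth x y z 1; apply.
by split; rewrite /= ?chart_mapK//; exact: chart_img_mem.
Qed.

Lemma mul_chart_lipschitz x y z a b :
  chart_dom (chart_at x) a -> chart_dom (chart_at y) b ->
  chart_dom (chart_at z) (a * b)%g ->
  exists2 d : R, 0 < d & exists L : R, forall p q : 'rV[R]_n * 'rV[R]_n,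
    `|p - (chart_at x a, chart_at y b)| < d ->
    `|q - (chart_at x a, chart_at y b)| < d ->
    `|mul_chart x y z q - mul_chart x y z p| <= L * `|q - p|.
Proof.
move=> xa yb zab.
exact: (C1_lipschitz (lie_mul_smooth x y z 1) (nbhs_mul_chart_dom xa yb zab)).
Qed.

Lemma diff_mul_chart_fst a b v :
  'd (mul_chart a b (a * b)%g) (chart_at a a, chart_at b b) (v, 0) =
  tangent_map (fun x => (x * b)%g) a v.
Proof.
have aa := chart_atP a; have bb := chart_atP b; have ab := chart_atP (a * b)%g.
have dmul := differentiable_mul_chart aa bb ab.
rewrite /tangent_map.
have -> : chart_at (a * b)%g \o (fun x => (x * b)%g) \o chart_inv (chart_at a) =
    mul_chart a b (a * b)%g \o (fun p => (p, chart_at b b)).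
  by apply/funext => p; rewrite /mul_chart /= chart_mapK.
have [dl dlE] : is_diff (chart_at a a)
    (fun p : 'rV[R]_n => (p, chart_at b b)) (fun p : 'rV[R]_n => (p, 0)).
  exact: (is_diff_pair (f := id) (g := cst (chart_at b b))).
have /(congr1 (@^~ v)) -> := diff_comp dl dmul.
by congr ('d _ _ _); rewrite dlE.
Qed.

Lemma diff_mul_chart_snd a b w :
  'd (mul_chart a b (a * b)%g) (chart_at a a, chart_at b b) (0, w) =
  tangent_map (fun x => (a * x)%g) b w.
Proof.
have aa := chart_atP a; have bb := chart_atP b; have ab := chart_atP (a * b)%g.
have dmul := differentiable_mul_chart aa bb ab.
rewrite /tangent_map.
have -> : chart_at (a * b)%g \o (fun x => (a * x)%g) \o chart_inv (chart_at b) =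
    mul_chart a b (a * b)%g \o (fun p => (chart_at a a, p)).
  by apply/funext => p; rewrite /mul_chart /= chart_mapK.
have [dl dlE] : is_diff (chart_at b b)
    (fun p : 'rV[R]_n => (chart_at a a, p)) (fun p : 'rV[R]_n => (0, p)).
  exact: (is_diff_pair (f := cst (chart_at a a)) (g := id)).
have /(congr1 (@^~ w)) -> := diff_comp dl dmul.
by congr ('d _ _ _); rewrite dlE.
Qed.

(** The product rule.  The velocity of [(c1, c2)] splits as
    [(v, 0) + (0, w)], and on each summand the differential of the multiplication
    is the differential of a translation, by the two lemmas above. *)
Lemma has_velocity_mul (c1 c2 : R -> G) t v w :
  has_velocity c1 t v -> has_velocity c2 t w ->
  has_velocity (fun s => (c1 s * c2 s)%g) t
    (tangent_map (fun x => (x * c2 t)%g) (c1 t) v +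
     tangent_map (fun x => (c1 t * x)%g) (c2 t) w).
Proof.
move=> [c1t c1v] [c2t c2w]; split.
  change ((fun s => c1 s * c2 s)%g @ t --> (c1 t * c2 t)%g).
  by apply: lie_mul_cvg.
have aa := chart_atP (c1 t); have bb := chart_atP (c2 t).
have dmul := differentiable_mul_chart aa bb (chart_atP (c1 t * c2 t)%g).
have := is_derive_diff_comp
  (g := fun s => (chart_at (c1 t) (c1 s), chart_at (c2 t) (c2 s)))
  dmul (is_derive_pair c1v c2w).
have -> : (v, w) = (v, 0) + (0, w) :> 'rV[R]_n * 'rV[R]_n.
  by congr (_, _); rewrite ?addr0 ?add0r.
rewrite linearD diff_mul_chart_fst diff_mul_chart_snd => Dmul.
apply: (@near_eq_is_derive _ _ _ _ _ _ _ _ _ Dmul).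
near=> s; rewrite /= mul_chartE//; near: s.
  exact: (c1t _ (nbhs_chart_dom aa)).
exact: (c2t _ (nbhs_chart_dom bb)).
Unshelve. all: by end_near. Qed.

End Multiplication.

(** * Linear vector fields *)

Section LinearFields.
Context {R : realType} {n : nat} {G : lieGroupType R n}.
Variables (X : vector_field G) (phi : R -> G -> G).
Hypothesis Xlin : linear_vf X phi.

Lemma linear_flow0 x : phi 0 x = x.
Proof. by have [_ [+ _ _] _] := Xlin; apply. Qed.

Lemma linear_flowD s t x : phi (s + t) x = phi s (phi t x).
Proof. by have [_ [_ + _] _] := Xlin; apply. Qed.

Lemma linear_flow_velocity t x : has_velocity (phi^~ x) t (X (phi t x)).
Proof. by have [_ [_ _ +] _] := Xlin; apply. Qed.

Lemma linear_flowM t x y : phi t (x * y)%g = (phi t x * phi t y)%g.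
Proof. by have [_ _ /(_ t)[+ _ _]] := Xlin; apply. Qed.

Lemma linear_flow1 t : phi t 1%g = 1%g.
Proof. by apply: (mulgI (phi t 1%g)); rewrite -linear_flowM !mulg1. Qed.

Lemma linear_flowNK t x : phi (- t) (phi t x) = x.
Proof. by rewrite -linear_flowD addNr linear_flow0. Qed.

Lemma linear_flowKN t x : phi t (phi (- t) x) = x.
Proof. by rewrite -linear_flowD addrN linear_flow0. Qed.

Lemma linear_vf1 : X 1%g = 0.
Proof.
have := linear_flow_velocity 0 1%g; rewrite linear_flow0.
have -> : phi^~ 1%g = (fun=> 1%g) by apply/funext => t; exact: linear_flow1.
by move=> /has_velocity_unique; apply; exact: has_velocity_cst.
Qed.

(** Each [phi s] is a homomorphism, so [phi s (x * y) = phi s x * phi s y];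
    this is the derivative of that identity at [s = 0]. *)
Lemma linear_vfM x y :
  X (x * y)%g = tangent_map (fun a => (a * y)%g) x (X x) +
                tangent_map (fun b => (x * b)%g) y (X y).
Proof.
have := has_velocity_mul (linear_flow_velocity 0 x) (linear_flow_velocity 0 y).
have := linear_flow_velocity 0 (x * y)%g; rewrite !linear_flow0.
have -> : phi^~ (x * y)%g = (fun s => (phi s x * phi s y)%g).
  by apply/funext => s; exact: linear_flowM.
exact: has_velocity_unique.
Qed.

Lemma linear_flow_continuous x : continuous (phi^~ x).
Proof. by move=> t; have [] := linear_flow_velocity t x. Qed.

End LinearFields.

(** * Solutions of the control system *)

Lemma linearD_sumZ {R : realType} {V W : normedModType R} {m : nat}
    (l : {linear V -> W}) (v : V) (a : 'I_m -> R) (w : 'I_m -> V) :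
  l (v + \sum_j a j *: w j) = l v + \sum_j a j *: l (w j).
Proof.
by rewrite linearD linear_sum; under eq_bigr do rewrite linearZ.
Qed.

Section Solutions.
Context {R : realType} {n m : nat} {G : lieGroupType R n}.
Variable S : linear_control_system m G.
Implicit Types (u : R -> 'rV[R]_m) (c : R -> G) (x z : G) (tau : R).
Local Notation mu := (@lebesgue_measure R).
Local Notation linS := (drift_linear S).

Definition control_field u t x : 'rV[R]_n :=
  drift S x + \sum_j u t ord0 j *: control_vf S j x.

(** Right translations carry the control fields to themselves, whereas the drift
    obeys the product rule; so the whole control dependence sits in the left
    factor, and the right factor only has to follow the drift. *)
Lemma tangent_mulr_control_field u t x y :
  control_field u t (x * y)%g =
  tangent_map (fun a => (a * y)%g) x (control_field u t x) +
  tangent_map (fun b => (x * b)%g) y (drift S y).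
Proof.
have ctrlE j : control_vf S j (x * y)%g =
    tangent_map (fun a => (a * y)%g) x (control_vf S j x).
  by have [_ /(_ x y)] := control_vfP S j.
rewrite /control_field (linear_vfM linS x y).
under eq_bigr do rewrite ctrlE.
have tangentE (v : 'rV[R]_n) (w : 'I_m -> 'rV[R]_n) :
    tangent_map (fun a => (a * y)%g) x (v + \sum_j u t ord0 j *: w j) =
    tangent_map (fun a => (a * y)%g) x v +
      \sum_j u t ord0 j *: tangent_map (fun a => (a * y)%g) x (w j).
  exact: linearD_sumZ.
by rewrite tangentE addrAC.
Qed.

(** The solution from [z] is the solution from the identity, multiplied on the
    right by the drift orbit of [z].  The differential equation is the product
    rule.  Absolute continuity is checked locally: near each [t], the
    multiplication read in charts is Lipschitz, the first factor is absolutely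
    continuous and the second is Lipschitz. *)
Lemma solution_mul_flow u tau c z : solution S u tau c ->
  solution S u tau (fun t => (c t * flow S t z)%g).
Proof.
move=> [cc cac cv]; split.
- apply/subspace_continuousP => t t0tau; apply: lie_mul_cvg.
    by move/subspace_continuousP : cc; apply.
  by apply: cvg_within_filter; exact: (linear_flow_continuous linS).
- move=> x a b a0 ab bt xab; apply: absolutely_continuous_local => t tab.
  have ct : chart_dom (chart_at (c t)) (c t) := chart_atP _.
  have ft : chart_dom (chart_at (flow S t z)) (flow S t z) := chart_atP _.
  have [d d0 [L FL]] := mul_chart_lipschitz ct ft (xab t tab).
  have [e e0 [K fK]] : exists2 e : R, 0 < e & exists K : R, forall s s',
      `|s - t| < e -> `|s' - t| < e ->
      `|chart_at (flow S t z) (flow S s' z) - chart_at (flow S t z) (flow S s z)|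
        <= K * `|s' - s|.
    have [sX _ _] := linS.
    exact: (integral_curve_lipschitz t sX ((linear_flow_velocity linS)^~ z)).
  have ccvg : c @ within `[0, tau] (nbhs t) --> c t.
    move/subspace_continuousP : cc; apply; rewrite /= in_itv /=; lra.
  have fcvg : (flow S)^~ z @ t --> flow S t z.
    exact: (linear_flow_continuous linS).
  have : \forall s \near t, s \in `[0, tau]%R ->
      chart_dom (chart_at (c t)) (c s) /\
      `|chart_at (c t) (c s) - chart_at (c t) (c t)| < d.
    exact: (near_chart d0 ccvg).
  move=> /nbhs_ballP[d1 /= d10 near1].
  have : \forall s \near t, chart_dom (chart_at (flow S t z)) (flow S s z) /\
      `|chart_at (flow S t z) (flow S s z) - chart_at (flow S t z) (flow S t z)| < d.
    exact: (near_chart d0 fcvg).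
  move=> /nbhs_ballP[d2 /= d20 near2].
  (* Halving puts the closed interval of radius r inside the open balls. *)
  pose r := Num.min e (Num.min d1 d2) / 2.
  have min0 : 0 < Num.min e (Num.min d1 d2) by rewrite !lt_min e0 d10.
  have r0 : 0 < r by rewrite divr_gt0.
  have [re rd1 rd2] : [/\ r < e, r < d1 & r < d2].
    have : r < Num.min e (Num.min d1 d2) by rewrite /r; lra.
    by rewrite !lt_min => /and3P[].
  exists r => //; set a' := Num.max a (t - r); set b' := Num.min b (t + r).
  have [aa' bb'] : a <= a' /\ b' <= b.
    by rewrite /a' /b' le_max ge_min !lexx.
  have in_r s : a' <= s <= b' -> `|s - t| <= r.
    rewrite /a' /b' ge_max le_min ler_norml => /andP[/andP[? ?] /andP[? ?]].
    by apply/andP; split; lra.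
  have c_near s : a' <= s <= b' -> chart_dom (chart_at (c t)) (c s) /\
      `|chart_at (c t) (c s) - chart_at (c t) (c t)| < d.
    move=> sab; apply: near1; last by rewrite in_itv /=; lra.
    by rewrite -ball_normE /= distrC (le_lt_trans (in_r _ sab)).
  have f_near s : a' <= s <= b' ->
      chart_dom (chart_at (flow S t z)) (flow S s z) /\
      `|chart_at (flow S t z) (flow S s z) - chart_at (flow S t z) (flow S t z)| < d.
    move=> sab; apply: near2.
    by rewrite -ball_normE /= distrC (le_lt_trans (in_r _ sab)).
  have [b'a'|/ltW a'b'] := leP b' a'.
    exact: absolutely_continuous_degenerate.
  have cac' : absolutely_continuous a' b' (chart_at (c t) \o c).
    apply: cac => //; [lra|lra|by move=> s /c_near[]].
  have fac' : absolutely_continuous a' b' (chart_at (flow S t z) \o (flow S)^~ z).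
    apply: (@absolutely_continuous_lip _ _ _ _ _ K) => s s' sab s'ab.
    by apply: fK; apply: le_lt_trans re; exact: in_r.
  apply: (@absolutely_continuous_le _ _ _ _ _ _ _ _ _ `|L| _ cac' fac').
  move=> s s' sab s'ab.
  have [cs cs'] := (c_near _ sab, c_near _ s'ab).
  have [fs fs'] := (f_near _ sab, f_near _ s'ab).
  rewrite /= -!(mul_chartE _ (cs.1) fs.1) -!(mul_chartE _ (cs'.1) fs'.1).
  apply: (le_trans (FL _ _ _ _)).
  + by rewrite prod_normE /= gt_max cs.2 fs.2.
  + by rewrite prod_normE /= gt_max cs'.2 fs'.2.
  apply: (@le_trans _ _ (`|L| *
     `|(chart_at (c t) (c s'), chart_at (flow S t z) (flow S s' z)) -
       (chart_at (c t) (c s), chart_at (flow S t z) (flow S s z))|)).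
    by rewrite ler_wpM2r// ler_norm.
  by rewrite ler_wpM2l// prod_normE /= ge_max lerDl lerDr !normr_ge0.
- move: cv; apply: filterS => t cv t0tau.
  have := has_velocity_mul (cv t0tau) (linear_flow_velocity linS t z).
  by rewrite -tangent_mulr_control_field.
Unshelve. all: by end_near. Qed.

(** The equation is autonomous, so a solution may be started at time [tau1]
    instead of [0].  At the junction the concatenated curve may have a corner,
    but a single instant is negligible. *)
Lemma solution_concat u1 u2 tau1 tau2 c1 c2 :
  0 <= tau1 -> 0 <= tau2 -> c1 tau1 = c2 0 ->
  solution S u1 tau1 c1 -> solution S u2 tau2 c2 ->
  solution S (fun t => if t <= tau1 then u1 t else u2 (t - tau1)) (tau1 + tau2)
    (fun t => if t <= tau1 then c1 t else c2 (t - tau1)).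
Proof.
move=> tau10 tau20 c12 [cc1 cac1 cv1] [cc2 cac2 cv2].
set u := fun t => if _ then u1 t else _.
set c := fun t => if _ then c1 t else _.
have cE1 t : t <= tau1 -> c t = c1 t by rewrite /c => ->.
have cE2 t : tau1 <= t -> c t = c2 (t - tau1).
  rewrite le_eqVlt => /predU1P[<-|tau1t]; first by rewrite cE1// subrr.
  by rewrite /c leNgt tau1t.
have uE1 t : t <= tau1 -> u t = u1 t by rewrite /u => ->.
have uE2 t : tau1 < t -> u t = u2 (t - tau1) by rewrite /u leNgt => ->.
split.
- have -> : `[0, tau1 + tau2]%classic = `[0, tau1] `|` `[tau1, tau1 + tau2] :> set R.
    apply/seteqP; split=> t /=; rewrite !in_itv /=; last by case; lra.
    by move=> ?; case: (leP t tau1) => ?; [left|right]; lra.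
  apply: withinU_continuous; [exact: interval_closed|exact: interval_closed| |].
    move: cc1; apply: subspace_eq_continuous => t.
    rewrite inE /= in_itv /= => /andP[_ ?]. by rewrite /from_subspace cE1.
  apply/subspace_continuousP => t; rewrite /= in_itv /= => tb.
  change (c @ within `[tau1, tau1 + tau2] (nbhs t) --> c t).
  rewrite cE2; last lra.
  have ct : c2 @ within `[0, tau2] (nbhs (t - tau1)) --> c2 (t - tau1).
    by move/subspace_continuousP : cc2; apply; rewrite /= in_itv /=; lra.
  have st : s - tau1 @[s --> t] --> t - tau1.
    by apply: cvgB; [exact: cvg_id|exact: cvg_cst].
  move=> U /ct c2U.
  have : \forall s \near t, s - tau1 \in `[0, tau2]%R -> U (c2 (s - tau1)).
    exact: (st _ c2U).
  move=> stU; change (\forall s \near t, s \in `[tau1, tau1 + tau2]%R -> U (c s)).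
  near=> s; rewrite in_itv /= => stau.
  rewrite cE2; last lra.
  have : s - tau1 \in `[0, tau2]%R by rewrite in_itv /=; lra.
  by near: s.
- have left_ac x a b : 0 <= a -> a <= b -> b <= tau1 ->
      (forall t, a <= t <= b -> chart_dom (chart_at x) (c t)) ->
      absolutely_continuous a b (chart_at x \o c).
    move=> a0 ab bt xc; have : absolutely_continuous a b (chart_at x \o c1).
      by apply: cac1 => // t tab; rewrite -cE1; [exact: xc|lra].
    by apply: absolutely_continuous_eq => t tab; rewrite /= cE1//; lra.
  have right_ac x a b : tau1 <= a -> a <= b -> b <= tau1 + tau2 ->
      (forall t, a <= t <= b -> chart_dom (chart_at x) (c t)) ->
      absolutely_continuous a b (chart_at x \o c).
    move=> a0 ab bt xc.
    have : absolutely_continuous (a - tau1) (b - tau1) (chart_at x \o c2).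
      apply: cac2 => [|||t tab]; [lra|lra|lra|].
      have -> : t = (t + tau1) - tau1 by rewrite addrK.
      by rewrite -cE2; [apply: xc; lra|lra].
    move=> /(absolutely_continuous_shift tau1); rewrite !subrK.
    by apply: absolutely_continuous_eq => t tab; rewrite /= cE2//; lra.
  move=> x a b a0 ab bt xc.
  have [btau|/ltW taub] := leP b tau1; first exact: left_ac.
  have [taua|/ltW ataua] := leP tau1 a; first exact: right_ac.
  apply: (@absolutely_continuous_glue _ _ _ tau1) => //.
    by apply: left_ac => // t tab; apply: xc; lra.
  by apply: right_ac => // t tab; apply: xc; lra.
- have {cv2} cv2 := ae_shift tau1 cv2.
  have tau1_ae : {ae mu, forall t, t != tau1}.
    exists [set tau1]; split; [exact: measurable_set1|exact: lebesgue_measure_set1|].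
    by move=> t /= /negP; rewrite negbK => /eqP.
  near=> t => /andP[t0 tt].
  have tneq : t != tau1 by near: t.
  case: (ltgtP t tau1) => [ttau|taut|teq]; last by rewrite teq eqxx in tneq.
  + have vel1 : 0 < t < tau1 -> has_velocity c1 t (control_field u1 t (c1 t)) by near: t.
    rewrite uE1 ?cE1 ?ltW//.
    apply: near_eq_has_velocity (vel1 _); last by rewrite t0.
    have := lt_nbhsl ttau; apply: filterS => s st.
    by rewrite cE1// ltW.
  + have vel2 : 0 < t - tau1 < tau2 -> has_velocity c2 (t - tau1)
       (control_field u2 (t - tau1) (c2 (t - tau1))) by near: t.
    rewrite uE2// cE2 ?ltW//.
    apply: near_eq_has_velocity (has_velocity_shift (vel2 _)); last lra.
    have := lt_nbhsr taut; apply: filterS => s st.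
    by rewrite cE2// ltW.
Unshelve. all: by end_near. Qed.

Lemma solution_cst1 tau : solution S (fun=> 0) tau (fun=> 1%g).
Proof.
split.
- by apply: continuous_subspaceT => t; exact: cvg_cst.
- move=> x a b _ _ _ _; apply: (@absolutely_continuous_lip _ _ _ _ _ 0) => s t _ _.
  by rewrite subrr normr0 mul0r.
- apply: aeW => t _; rewrite (linear_vf1 linS) add0r big1 => [|j _].
    exact: has_velocity_cst.
  by rewrite mxE scale0r.
Qed.

End Solutions.

Section Admissible.
Context {R : realType} {m : nat}.
Variable Omega : set 'rV[R]_m.
Local Notation mu := (@lebesgue_measure R).

Lemma admissible_cst0 : Omega 0 -> admissible Omega (fun=> 0).
Proof.
move=> Omega0; split; last exact: aeW.
move=> j; apply: (@Lfun_pinfty_ae_bounded _ _ 0).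
  by under eq_fun do rewrite mxE; exact: measurable_cst.
by apply: aeW => t; rewrite mxE normr0.
Qed.

Lemma admissible_concat u1 u2 (tau : R) : compact Omega ->
  admissible Omega u1 -> admissible Omega u2 ->
  admissible Omega (fun t => if t <= tau then u1 t else u2 (t - tau)).
Proof.
move=> Oc [u1m u1O] [u2m u2O]; have {}u2O := ae_shift tau u2O.
have uO : {ae mu, forall t, Omega (if t <= tau then u1 t else u2 (t - tau))}.
  by move: u1O u2O; apply: filterS2 => t ? ?; case: ifP.
split=> // j.
have [M OM] : exists M, forall v, Omega v -> `|v| <= M.
  have /compact_bounded[M [_ OM]] := Oc; exists (M + 1) => v Ov.
  by apply: OM => //; rewrite ltrDl.
apply: (@Lfun_pinfty_ae_bounded _ _ M); last first.
  by move: uO; apply: filterS => t /OM; exact/le_trans/coord_le_norm.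
have -> : (fun t => (if t <= tau then u1 t else u2 (t - tau)) ord0 j) =
    (fun t => if t <= tau then u1 t ord0 j else u2 (t - tau) ord0 j).
  by apply/funext => t; case: ifP.
apply: measurable_fun_ifT.
- by apply: measurable_fun_ler; [exact: measurable_id|exact: measurable_cst].
- exact: Lfun_measurable.
- exact: (measurableT_comp (Lfun_measurable (u2m j)) (measurable_shift tau)).
Qed.
End Admissible.

(** * The reachable set and its core *)

Section Reachable.
Context {R : realType} {n m : nat} {G : lieGroupType R n}.
Variable S : linear_control_system m G.
Local Notation linS := (drift_linear S).
Local Notation omega0 := (nbhs_singleton (control_range_0 S)).

Lemma reachable_at1 (tau : R) : reachable_at S tau 1%g.
Proof.
exists (fun=> 0), (fun=> 1%g); split => //; last exact: solution_cst1.
exact/admissible_cst0/omega0.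
Qed.

(** Steer from the identity to [z], then apply the control that reaches [x] in
    time [tau]: started at [z] it ends at [x * flow S tau z]. *)
Lemma reachable_mul_flow (tau : R) (x z : G) : 0 <= tau ->
  reachable_at S tau x -> reachable S z -> reachable S (x * flow S tau z)%g.
Proof.
move=> tau0 [u2 [c2 [u2a sol2 c20 <-]]] [sigma /= sigma0 [u1 [c1 [u1a sol1 c10 c1z]]]].
exists (sigma + tau) => /=; first by rewrite ltr_wpDr.
have start2 : c1 sigma = (c2 0 * flow S 0 z)%g.
  by rewrite c20 (linear_flow0 linS) mul1g.
exists (fun t => if t <= sigma then u1 t else u2 (t - sigma)).
exists (fun t => if t <= sigma then c1 t
                 else (c2 (t - sigma) * flow S (t - sigma) z)%g).
split.
- by apply: admissible_concat => //; exact: control_range_compact.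
- exact: (solution_concat (ltW sigma0) tau0 start2 sol1 (solution_mul_flow z sol2)).
- by rewrite (ltW sigma0).
- case: ifP => [st|_]; last by rewrite addrC addKr.
  have -> : tau = 0 by lra.
  by rewrite addr0 start2.
Qed.

(** The forward invariance of the reachable set under the drift is the case of
    the zero control, which keeps the identity fixed. *)
Lemma reachable_flow (t : R) (x : G) : 0 <= t -> reachable S x ->
  reachable S (flow S t x).
Proof.
move=> t0 /(reachable_mul_flow t0 (reachable_at1 t)).
by rewrite mul1g.
Qed.

Lemma image_flowP (t : R) (A : set G) (x : G) :
  (flow S t @` A) x <-> A (flow S (- t) x).
Proof.
split=> [[y Ay <-]|Ax]; first by rewrite (linear_flowNK linS).
by exists (flow S (- t) x) => //; rewrite (linear_flowKN linS).
Qed.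

Lemma reachable_coreP (x : G) :
  reachable_core S x <-> forall t, reachable S (flow S t x).
Proof.
split=> [Sx t|Sx t _]; last by apply/image_flowP.
by have /image_flowP := Sx (- t) I; rewrite opprK.
Qed.

(** A late enough past of the orbit of [x] is enough: the rest of the orbit lies
    in its future under the drift. *)
Lemma reachable_core_past (tau0 : R) (x : G) :
  (forall t, tau0 <= t -> reachable S (flow S (- t) x)) -> reachable_core S x.
Proof.
move=> xpast; apply/reachable_coreP => t.
have [tt|tt] := leP tau0 (- t); first by rewrite -[t]opprK; exact: xpast.
have -> : t = (t + tau0) + - tau0 by rewrite addrK.
rewrite (linear_flowD linS); apply: reachable_flow; last exact: xpast.
by lra.
Qed.

End Reachable.

Theorem proposition3p1 (R : realType) (n m : nat) (G : lieGroupType R n)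
    (hG : connected [set: G]) (S : linear_control_system m G)
    (D : vector_field G -> vector_field G)
    (hD : derivation_of_flow (flow S) D) (hrank : rank_condition S D) :
  [/\ [/\ flow_invariant (flow S) (reachable_core S),
          reachable_core S `<=` reachable S &
          forall C : set G, flow_invariant (flow S) C -> C `<=` reachable S ->
            C `<=` reachable_core S],
      forall tau0 : R, 0 <= tau0 ->
        reachable_core S =
        \bigcap_(t in [set t : R | tau0 <= t]) (flow S t @` reachable S),
      forall x : G, reachable_core S x <->
        forall t : R, t <= 0 -> reachable S (flow S t x) &
      forall x y : G, reachable_core S x -> reachable_core S y ->
        reachable_core S (x * y)%g].
Proof.
have linS := drift_linear S.
split; [split| | |].
- move=> s; apply/seteqP; split=> x; rewrite image_flowP !reachable_coreP => Sx t.
    by have := Sx (t + s); rewrite -(linear_flowD linS) addrK.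
  by rewrite -(linear_flowD linS).
- by move=> x /reachable_coreP/(_ 0); rewrite (linear_flow0 linS).
- move=> C Cinv CA x Cx; apply/reachable_coreP => t; apply: CA.
  by rewrite -(Cinv t); exists x.
- move=> tau0 _; apply/seteqP; split=> x.
    by move=> Sx t _; exact: Sx.
  by move=> Sx; apply: (@reachable_core_past _ _ _ _ _ tau0) => t /Sx/image_flowP.
- move=> x; split=> [/reachable_coreP Sx t _ //|Sx].
  apply: (@reachable_core_past _ _ _ _ _ 0) => t t0; apply: Sx.
  by rewrite oppr_le0.
- move=> x y /reachable_coreP Sx /reachable_coreP Sy; apply/reachable_coreP => t.
  rewrite (linear_flowM linS); have [tau tau0 xtau] := Sx t.
  have -> : flow S t y = flow S tau (flow S (- tau + t) y).
    by rewrite (linear_flowD linS) (linear_flowKN linS).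
  exact: (reachable_mul_flow (ltW tau0) xtau (Sy _)).
Qed.
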